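(* Let $n \ge 4$ be an integer with $\{\log_2 n\} \ge \{\log_2 3\}$. If $r$ is a positive integer such that $\{\log_2 n\} < \frac{\lfloor r/2 \rfloor + 1}{r}$, then $\mathsf{D}_{\pm}(C_n^r) = \lfloor r \log_2 n \rfloor + 1$.
   Context: $C_n^r$ denotes the direct sum of $r$ copies of a cyclic group of order $n$; $\{x\} = x - \lfloor x\rfloor$ is the fractional part. For a finite abelian group $G$ (written additively), $\mathsf{D}_{\pm}(G)$ is the smallest positive integer $\ell$ such that for every sequence $g_1,\dots,g_k$ of elements of $G$ (repetitions allowed) with $k \ge \ell$ there exist a non-empty subset $I \subset \{1,\dots,k\}$ and $a_i \in \{+1,-1\}$ ($i\in I$) with $\sum_{i \in I} a_i g_i = 0$. *)

(* Defs.v *)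
From mathcomp Require Import all_boot all_order all_algebra.
From mathcomp Require Import boolp reals exp.

Set Implicit Arguments.
Unset Strict Implicit.
Unset Printing Implicit Defensive.

Import Order.TTheory GRing.Theory Num.Theory.
Local Open Scope ring_scope.

Definition log2 {R : realType} (x : R) : R := ln x / ln 2.

Definition fracpart {R : realType} (x : R) : R := x - (Num.floor x)%:~R.

Definition has_pm_zero_sum (G : zmodType) (k : nat) (g : 'I_k -> G) : Prop :=
  exists (I : {set 'I_k}) (a : 'I_k -> int),
    [/\ I != set0,
        forall i, i \in I -> a i = 1 \/ a i = -1
      & \sum_(i in I) g i *~ a i = 0].

Definition pm_bound (G : zmodType) (l : nat) : Prop :=
  (0 < l)%N /\
  forall (k : nat) (g : 'I_k -> G), (l <= k)%N -> has_pm_zero_sum g.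

(* If 2 ^ k > |G|, two distinct subsets of 'I_k have the same sum; subtracting
   gives a plus-minus zero-sum over their symmetric difference. *)
Lemma pm_bound_card (G : finZmodType) : pm_bound G #|G|.
Proof.
split=> [|k g lek]; first by apply/card_gt0P; exists 0.
pose S (A : {set 'I_k}) := \sum_(i in A) g i.
have /injectivePn [A [B neAB eqS]] : ~~ injectiveb S.
  apply/negP => /injectiveP injS.
  have := leq_card S injS; rewrite -cardsT -powersetT card_powerset cardsT card_ord leqNgt => /negP; apply.
  exact: leq_ltn_trans lek (ltn_expl _ _).
pose a i : int := (i \in A)%:R - (i \in B)%:R.
exists [set i | (i \in A) != (i \in B)], a; split.
- apply: contraNneq neAB => AB0; apply/eqP/setP => i.
  by have := in_set0 i; rewrite -AB0 inE => /negbFE/eqP.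
- move=> i; rewrite inE /a.
  by case: (i \in A); case: (i \in B) => // _; [left|right].
- rewrite -[RHS](subrr (S A)) [in X in _ - X]eqS /S.
  rewrite !(big_mkcond (fun i => i \in _)) /= -sumrB; apply: eq_bigr => i _.
  rewrite inE /a; case: (i \in A); case: (i \in B) => /=;
    by rewrite ?subrr ?subr0 ?sub0r ?mulr1z ?mulrN1z.
Qed.

Lemma pm_bound_exists (G : finZmodType) : exists l, `[< pm_bound G l >].
Proof. by exists #|G|; apply/asboolP; exact: pm_bound_card. Qed.

Definition Dpm (G : finZmodType) : nat := ex_minn (pm_bound_exists G).

(* Main.v *)
(** Write [m] for the integer part of [log2 n]. The hypotheses on fractional
    parts say that [3 * 2 ^ (m - 1) <= n] and [n ^ r < 2 ^ (r m + r/2 + 1)] with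
    [r/2] rounded down. The second bound gives the upper estimate by pigeonhole
    on subset sums. For the lower estimate it suffices to find [m] elements in
    rank 1 and [2 m + 1] elements in rank 2 with no plus-minus zero-sum, and to
    take direct sums. At scale [s = 2 ^ (m - 2)], so that [6 s <= n], five
    explicit vectors of the plane work with room [s] to spare in the sup norm;
    then the scale is halved [m - 2] times, each time adjoining the standard
    basis multiplied by the current scale. *)
Require Import Defs.
From mathcomp Require Import all_boot all_order all_algebra.
From mathcomp Require Import zify.
From mathcomp Require Import boolp reals exp.

Import Order.TTheory GRing.Theory Num.Theory.
Local Open Scope ring_scope.

Lemma has_pm_zero_sum_lt_card (G : finZmodType) (k : nat) (g : 'I_k -> G) :
  (#|G| < 2 ^ k)%N -> has_pm_zero_sum g.
Proof.
move=> ltGk; pose S (A : {set 'I_k}) := \sum_(i in A) g i.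
have /injectivePn[A [B neAB eqS]] : ~~ injectiveb S.
  apply/negP => /injectiveP injS; have := leq_card S injS.
  by rewrite -cardsT -powersetT card_powerset cardsT card_ord leqNgt ltGk.
pose a i : int := (i \in A)%:R - (i \in B)%:R.
exists [set i | (i \in A) != (i \in B)], a; split.
- apply: contraNneq neAB => AB0; apply/eqP/setP => i.
  by have := in_set0 i; rewrite -AB0 inE => /negbFE/eqP.
- move=> i; rewrite inE /a.
  by case: (i \in A); case: (i \in B) => // _; [left | right].
- rewrite -[RHS](subrr (S A)) [in X in _ - X]eqS /S.
  rewrite !(big_mkcond (fun i => i \in _)) /= -sumrB; apply: eq_bigr => i _.
  rewrite inE /a; case: (i \in A); case: (i \in B) => /=;
    by rewrite ?subrr ?subr0 ?sub0r ?mulr1z ?mulrN1z.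
Qed.

Lemma Dpm_eqS (G : finZmodType) (k : nat) (g : 'I_k -> G) :
  ~ has_pm_zero_sum g -> (#|G| < 2 ^ k.+1)%N -> Dpm G = k.+1.
Proof.
move=> ng ltGk; rewrite /Dpm; case: ex_minnP => l /asboolP[_ bl] minl.
apply/eqP; rewrite eqn_leq minl /=; last first.
  apply/asboolP; split=> // k' g' lek; apply: has_pm_zero_sum_lt_card.
  by apply: leq_trans ltGk _; rewrite leq_exp2l.
by rewrite ltnNge; apply/negP => /(bl k g).
Qed.

(* A scale-[s] relaxation of dissociativity: the [k] rows of [A] are integer
   vectors whose nontrivial combinations with coefficients in {-1, 0, 1} avoid
   the open sup-norm balls of radius [s] around [n Z^d]. *)
Definition spread (n d k s : nat) : Prop :=
  exists A : 'M[int]_(k, d), forall c : 'rV[int]_k,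
    (forall i, `|c 0 i| <= 1) -> c != 0 ->
    exists j, forall q : int, s%:Z <= `|(c *m A) 0 j - q * n%:Z|.

(** Stack the two families block-diagonally: a nonzero [c] is nonzero on one block, and the
    coordinates of that block see nothing of the other. *)
Lemma spread_cat (n d1 d2 k1 k2 s : nat) :
  spread n d1 k1 s -> spread n d2 k2 s -> spread n (d1 + d2) (k1 + k2) s.
Proof.
move=> [A1 H1] [A2 H2]; exists (block_mx A1 0 0 A2) => c.
rewrite -[c]hsubmxK; set c1 := lsubmx c; set c2 := rsubmx c.
rewrite mul_row_block !mulmx0 addr0 add0r row_mx_eq0 => c_le1.
have c1_le1 i : `|c1 0 i| <= 1 by have := c_le1 (lshift _ i); rewrite row_mxEl.
have c2_le1 i : `|c2 0 i| <= 1 by have := c_le1 (rshift _ i); rewrite row_mxEr.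
case: (eqVneq c1 0) => [_ /= c2_neq0 | c1_neq0 _].
  have [j Hj] := H2 _ c2_le1 c2_neq0; exists (rshift _ j) => q.
  by rewrite row_mxEr.
have [j Hj] := H1 _ c1_le1 c1_neq0; exists (lshift _ j) => q.
by rewrite row_mxEl.
Qed.

(** For [q] nonzero, [q * n] has absolute value at least [n], and the reverse triangle inequality
    leaves [s]. *)
Lemma le_dist_multiple (n s : nat) (t q : int) :
  s%:Z <= `|t| -> `|t| + s%:Z <= n%:Z -> s%:Z <= `|t - q * n%:Z|.
Proof.
move=> le_st le_tn; have [->|q_neq0] := eqVneq q 0.
  by rewrite mul0r subr0.
have le_nq : n%:Z <= `|q * n%:Z|.
  rewrite normrM [`|n%:Z|]ger0_norm // ler_peMl //.
  by rewrite -gtz0_ge1 normr_gt0.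
have := lerB_dist (q * n%:Z) t; rewrite distrC; lia.
Qed.

(** Adjoin [s] times the standard basis. If the old part [c1] is nonzero, the new rows move each
    coordinate by at most [s], half of the room; if it is zero, some coordinate is exactly [s] or
    [-s]. *)
Lemma spread_half (n d k s : nat) :
  (2 * s <= n)%N -> spread n d k (2 * s) -> spread n d (k + d) s.
Proof.
move=> le2sn [A HA]; exists (col_mx A s%:Z%:M) => c.
rewrite -[c]hsubmxK; set c1 := lsubmx c; set c2 := rsubmx c.
rewrite mul_row_col mul_mx_scalar row_mx_eq0 => c_le1.
have c1_le1 i : `|c1 0 i| <= 1 by have := c_le1 (lshift _ i); rewrite row_mxEl.
have c2_le1 i : `|c2 0 i| <= 1 by have := c_le1 (rshift _ i); rewrite row_mxEr.
case: (eqVneq c1 0) => [-> /= c2_neq0 | c1_neq0 _].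
  have /rV0Pn[j c2j_neq0] := c2_neq0; exists j => q.
  rewrite mul0mx add0r mxE.
  have c2j1 : `|c2 0 j| = 1.
    by apply/eqP; rewrite eq_le c2_le1 -gtz0_ge1 normr_gt0.
  by apply: le_dist_multiple; rewrite normrM c2j1; lia.
have [j Hj] := HA _ c1_le1 c1_neq0; exists j => q; have {}Hj := Hj q.
rewrite mxE [(s%:Z *: c2) 0 j]mxE; set t := (c1 *m A) 0 j in Hj *.
have le_sc : `|s%:Z * c2 0 j| <= s%:Z by rewrite normrM ler_piMr.
have := lerB_dist (t - q * n%:Z) (- (s%:Z * c2 0 j)).
rewrite normrN opprK addrAC; apply: le_trans.
by apply: le_trans (lerB Hj le_sc); lia.
Qed.

Lemma spread_halves (n d k s m : nat) :
  (2 ^ m * s <= n)%N -> spread n d k (2 ^ m * s) -> spread n d (k + m * d) s.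
Proof.
elim: m s => [|m IHm] s; first by rewrite mul1n mul0n addn0.
rewrite expnSr -mulnA => le_n spr.
rewrite mulSn [(d + _)%N]addnC addnA; apply: spread_half; last exact: IHm.
by apply: leq_trans le_n; rewrite leq_pmull ?expn_gt0.
Qed.

Lemma spread_no_pm_zero_sum (n d k : nat) : (1 < n)%N -> spread n d k 1 ->
  exists g : 'I_k -> 'rV['Z_n]_d, ~ has_pm_zero_sum g.
Proof.
move=> n_gt1 [A HA]; exists (fun i => map_mx intr (row i A)).
move=> [I [a [I_neq0 a_pm1 sum0]]].
pose c : 'rV[int]_k := \row_i (if i \in I then a i else 0).
have [||j Hj] := HA c.
- by move=> i; rewrite mxE; case: ifP => // /a_pm1[]->.
- have [i Ii] := set0Pn _ I_neq0; apply/rV0Pn; exists i.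
  by rewrite mxE Ii; case: (a_pm1 _ Ii) => ->.
have cA0 : ((c *m A) 0 j)%:~R = 0 :> 'Z_n.
  have := congr1 (fun v : 'rV_d => v 0 j) sum0; rewrite summxE !mxE => <-.
  rewrite rmorph_sum /= [RHS]big_mkcond /=; apply: eq_bigr => i _.
  rewrite mxE; case: ifP => [Ii|_]; last by rewrite mul0r.
  case: (a_pm1 _ Ii) => ->; rewrite ?mulr1z ?mulrN1z !mxE.
    by rewrite mul1r.
  by rewrite mulN1r rmorphN.
set t := (c *m A) 0 j in cA0 Hj.
have n_neq0 : n%:Z != 0 by case: (n) n_gt1.
(* Taking the quotient for [q] leaves the remainder, which must be nonzero; but [cA0] makes it zero
   modulo [n]. *)
have := Hj (t %/ n)%Z; rewrite {1}(divz_eq t n) addrC addKr.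
have := modz_ge0 t n_neq0; have := divz_eq t n.
case: (t %% n)%Z (ltz_pmod t (ltnW n_gt1 : 0 < n%:Z)) => // u lt_un def_t _.
move: cA0; rewrite def_t rmorphD rmorphM /= -!pmulrn pchar_Zp // mulr0 add0r.
move/(congr1 val); rewrite /= val_Zp_nat // modn_small //= => ->.
by rewrite normr0.
Qed.

Lemma spread_line (n s : nat) : (4 * s <= n)%N -> spread n 1 2 s.
Proof.
(* Start from the empty family, spread at every scale since it has no nonzero [c]; two halvings add
   one row each. *)
move=> le4n; apply: (@spread_halves n 1 0 s 2) => //.
by exists 0 => c; rewrite [c]thinmx0 eqxx.
Qed.

(* Every nontrivial combination of the five rows has a coordinate [x] with
   [1 <= `|x| <= 5], which is at distance at least 1 from the multiples of any
   real number that is at least 6, here [n / s]. *)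
Lemma spread_plane (n s : nat) : (6 * s <= n)%N -> spread n 2 5 s.
Proof.
move=> le6n.
pose W (j : 'I_2) : seq int :=
  if j == 0 then [:: 3; 1; 0; 2; 1] else [:: 0; 1; 1; - 3; - 1].
exists (s%:Z *: \matrix_(i, j) (W j)`_i) => c c_le1 c_neq0.
pose z k := c 0 (inord k).
have z_le1 k : -1 <= z k <= 1 by rewrite -ler_norml c_le1.
have cW j : (c *m \matrix_(i, j) (W j)`_i) 0 j = \sum_(i < 5) z i * (W j)`_i.
  by rewrite mxE; apply: eq_bigr => i _; rewrite mxE /z inord_val.
suff [j /andP[x_ge1 x_le5]] :
    exists j, 1 <= `|\sum_(i < 5) z i * (W j)`_i| <= 5.
  exists j => q; rewrite -scalemxAr mxE cW.
  by apply: le_dist_multiple; rewrite normrM; nia.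
have [x_good|x_bad] := boolP (1 <= `|\sum_(i < 5) z i * (W 0)`_i| <= 5).
  by exists 0.
(* It remains to see that two bad coordinates force [c = 0]. The lists in [W] have absolute sums 7
   and 6, so a bad coordinate is 0 or nearly extremal, which leaves few cases to linear
   arithmetic. *)
exists 1; apply: contraNT c_neq0 => y_bad; apply/eqP/rowP => i.
rewrite mxE -[i]inord_val -/(z i); move: x_bad y_bad.
rewrite !big_ord_recl !big_ord0 /= /bump /= !add1n.
have bad (t : int) : ~~ (1 <= `|t| <= 5) -> t = 0 \/ 6 <= t \/ t <= -6.
  by have [t_ge0|t_lt0] := lerP 0 t; lia.
move=> /bad x_bad /bad y_bad.
have := z_le1 4%N; have := z_le1 3%N; have := z_le1 2%N.
have := z_le1 1%N; have := z_le1 0%N.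
by case: i => [[|[|[|[|[|//]]]]] _] /=; lia.
Qed.

Lemma spread_dim (n m r : nat) :
  (1 < m)%N -> (3 * 2 ^ m.-1 <= n)%N -> spread n r (r * m + r./2) 1.
Proof.
(* From here [m] is the original one minus 2. With [r = 2 * q + b], the base uses [q] planes and [b]
   lines at scale [2 ^ m]. *)
case: m => [|[|m]] // _; rewrite expnS mulnA => le6n.
have base q (b : bool) : spread n (q * 2 + b) (q * 5 + b * 2) (2 ^ m).
  elim: q => [|q IHq].
    case: b; last by exists 0 => c; rewrite [c]thinmx0 eqxx.
    by apply: spread_line; apply: leq_trans le6n; rewrite leq_mul2r orbT.
  by rewrite !mulSn -!addnA; apply: spread_cat IHq; apply: spread_plane.
have def_r : (r./2 * 2 + odd r = r)%N by rewrite muln2 addnC odd_double_half.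
have := base r./2 (odd r); rewrite def_r -[X in spread _ _ _ X]muln1.
move/spread_halves => /(_ _); rewrite muln1.
have -> : (r./2 * 5 + odd r * 2 + m * r = r * m.+2 + r./2)%N by lia.
by apply; lia.
Qed.

Lemma ln2_gt0 (R : realType) : 0 < ln (2 : R).
Proof. by rewrite ln_gt0 // ltr1n. Qed.

Lemma ltr_log2 (R : realType) (a b : nat) : (0 < a)%N -> (0 < b)%N ->
  (log2 (a%:R : R) < log2 b%:R) = (a < b)%N.
Proof.
move=> a_gt0 b_gt0; rewrite /log2 ltr_pM2r ?invr_gt0 ?ln2_gt0 //.
by rewrite ltr_ln ?posrE ?ltr0n // ltr_nat.
Qed.

Lemma ler_log2 (R : realType) (a b : nat) : (0 < a)%N -> (0 < b)%N ->
  (log2 (a%:R : R) <= log2 b%:R) = (a <= b)%N.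
Proof. by move=> a_gt0 b_gt0; rewrite leNgt ltr_log2 // -leqNgt. Qed.

Lemma log2M (R : realType) (a b : nat) : (0 < a)%N -> (0 < b)%N ->
  log2 ((a * b)%:R : R) = log2 a%:R + log2 b%:R.
Proof.
by move=> a_gt0 b_gt0; rewrite /log2 natrM lnM ?posrE ?ltr0n // mulrDl.
Qed.

Lemma log2X (R : realType) (a k : nat) : (0 < a)%N ->
  log2 ((a ^ k)%:R : R) = k%:R * log2 a%:R.
Proof.
by move=> a_gt0; rewrite /log2 natrX lnXn ?ltr0n // mulrA mulr_natl.
Qed.

Lemma log2_2 (R : realType) : log2 (2 : R) = 1.
Proof. by rewrite /log2 divff // gt_eqF // ln2_gt0. Qed.

Lemma log2_exp2 (R : realType) (k : nat) : log2 ((2 ^ k)%:R : R) = k%:R.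
Proof. by rewrite log2X // log2_2 mulr1. Qed.

Lemma floor_log2 (R : realType) (a k : nat) : (2 ^ k <= a < 2 ^ k.+1)%N ->
  Num.floor (log2 (a%:R : R)) = k.
Proof.
move=> /andP[le_ka lt_ak]; have a_gt0 : (0 < a)%N.
  by apply: leq_trans le_ka; rewrite expn_gt0.
apply: floor_def; rewrite -[_ + 1]/(k + 1)%N%:Z addn1 -!pmulrn.
rewrite -(log2_exp2 R k) -(log2_exp2 R k.+1).
by rewrite ler_log2 ?ltr_log2 ?expn_gt0 ?le_ka.
Qed.

Theorem theorem4p3 (R : realType) (n : nat) (hn : (4 <= n)%N)
    (hfrac : fracpart (log2 (3%:R : R)) <= fracpart (log2 (n%:R : R)))
    (r : nat) (hr : (0 < r)%N)
    (hlt : fracpart (log2 (n%:R : R)) < (r %/ 2 + 1)%:R / r%:R) :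
  (Dpm 'rV['Z_n]_r)%:Z = Num.floor (r%:R * log2 (n%:R : R)) + 1.
Proof.
have n_gt0 : (0 < n)%N by apply: leq_trans hn.
have n_gt1 : (1 < n)%N by apply: leq_trans hn.
have [m /andP[m_gt1 n_m]] : exists m, (1 < m)%N && (2 ^ m <= n < 2 ^ m.+1)%N.
  exists (trunc_log 2 n); apply/andP; split; last exact: trunc_log_bounds.
  exact: trunc_log_max.
have card_G : #|'rV['Z_n]_r| = (n ^ r)%N.
  by rewrite card_mx mul1n card_ord Zp_cast.
move: hfrac hlt; rewrite /fracpart (floor_log2 _ _ _ n_m) (floor_log2 _ 3 1) //.
rewrite -!pmulrn lerBlDr addrAC -lerBlDr opprK => hfrac.
rewrite ltr_pdivlMr ?ltr0n // divn2 => hlt.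
have n_ge : (3 * 2 ^ m.-1 <= n)%N.
  (* Doubling turns the goal into [3 * 2 ^ m <= n * 2], whose logarithm is [hfrac]. *)
  rewrite -(leq_pmul2r (isT : 0 < 2)%N) -mulnA -expnSr prednK ?(ltnW m_gt1) //.
  rewrite -(ler_log2 R) ?muln_gt0 ?expn_gt0 ?n_gt0 //.
  by rewrite !log2M ?expn_gt0 // log2_exp2 log2_2.
have [g g_free] :=
  spread_no_pm_zero_sum _ _ _ n_gt1 (spread_dim _ _ r m_gt1 n_ge).
have lt_nr : (n ^ r < 2 ^ (r * m + r./2).+1)%N.
  rewrite -(ltr_log2 R) ?expn_gt0 ?n_gt0 // log2_exp2 log2X //.
  move: hlt; rewrite mulrBl ltrBlDr mulrC -natrM -natrD mulnC.
  by congr (_ < _%:R); lia.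
have le_nr : (2 ^ (r * m + r./2) <= n ^ r)%N.
  rewrite leqNgt -card_G; apply/negP => lt_card.
  exact/g_free/has_pm_zero_sum_lt_card.
rewrite (Dpm_eqS _ _ g) // ?card_G // -log2X // (floor_log2 _ _ (r * m + r./2)).
  by rewrite -addn1 PoszD.
by rewrite le_nr lt_nr.
Qed.
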